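(* Let $2p+1$ be an odd number with $p \ge 1$. There is an integer $N(p)$ and a holomorphic polynomial mapping $g_p$ of degree $2p$ such that $$ g_p : Q(2,2p+1) \to Q(N(p),2p+1), $$ and $g_p$ maps to no hyperquadric with smaller numbers of positive or negative eigenvalues.
   Context: The hyperquadric $Q(a,b)$ is the subset of complex Euclidean space $\mathbb{C}^{a+b}$ defined by $$ \sum_{j=1}^{a} |z_j|^2 - \sum_{j=a+1}^{a+b} |z_j|^2 = 1 . $$ The numbers of positive and negative eigenvalues of the hyperquadric $Q(a,b)$ are those in its defining equation, namely $a$ and $b$ respectively. The notation $g_p : Q(2,2p+1) \to Q(N(p),2p+1)$ means that the polynomial mapping $g_p$, from $\mathbb{C}^{2p+3}$ to $\mathbb{C}^{N(p)+2p+1}$, sends the first hyperquadric into the second. *)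

(* Defs.v *)
From HB Require Import structures.
From mathcomp Require Import all_boot all_order all_algebra.
From mathcomp Require Import reals complex.
From mathcomp Require Import mpoly.

Set Implicit Arguments.
Unset Strict Implicit.
Unset Printing Implicit Defensive.

Import Order.TTheory GRing.Theory Num.Theory.
Local Open Scope ring_scope.

(* Points of C^n are row vectors over R[i]; in R[i] the norm `|z| is the
   modulus, seen as an element of R[i]. *)
Definition hyperquadric (R : realType) (a b : nat) (z : 'rV[R[i]]_(a + b)) :
    Prop :=
  \sum_(j < a) `|z 0 (lshift b j)| ^+ 2
    - \sum_(j < b) `|z 0 (rshift a j)| ^+ 2 = 1.

Arguments hyperquadric {R} a b z.

Definition poly_map (R : realType) (m n : nat) := 'I_n -> {mpoly R[i][m]}.

Definition eval_map (R : realType) (m n : nat) (g : poly_map R m n)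
    (z : 'rV[R[i]]_m) : 'rV[R[i]]_n :=
  \row_(i < n) (g i).@[z 0].

(* msize is the total degree plus one, and 0 for the zero polynomial. *)
Definition map_degree (R : realType) (m n : nat) (g : poly_map R m n) : nat :=
  \max_(i < n) (msize (g i)).-1.

Definition maps_hyperquadric (R : realType) (a b A B : nat)
    (f : 'rV[R[i]]_(a + b) -> 'rV[R[i]]_(A + B)) : Prop :=
  forall z, hyperquadric a b z -> hyperquadric A B (f z).

Arguments maps_hyperquadric {R} a b A B f.

(* As Q(A,B) lives in C^(A+B), asking whether a map f into C^n also maps into
   a hyperquadric with A positive and B negative eigenvalues requires letting
   affine coordinates on C^n vary.  Here the hyperquadric is the inverse image
   of Q(A,B) under a surjective affine map w |-> w M + v (row_full M is
   surjectivity; without it M = 0 would be allowed): these are the real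
   quadrics of C^n whose equation is, in suitable affine coordinates, that of
   Q(A,B).  A + B < n is allowed, which covers the maps whose image lies in a
   copy of Q(A,B) inside a proper affine subspace of C^n (compose with an
   affine projection onto the subspace). *)
Definition maps_to_some_hyperquadric (R : realType) (a b n : nat)
    (f : 'rV[R[i]]_(a + b) -> 'rV[R[i]]_n) (A B : nat) : Prop :=
  exists (M : 'M[R[i]]_(n, A + B)) (v : 'rV[R[i]]_(A + B)),
    row_full M /\ maps_hyperquadric a b A B (fun z => f z *m M + v).

Arguments maps_to_some_hyperquadric {R} a b {n} f A B.

(* Main.v *)
(* Write s for |z_1|^2 + |z_2|^2 and t for the sum of the other |z_j|^2, so
   that Q(2, 2p+1) is s = 1 + t.  Let V_0 = 2, V_1 = t and
   V_(n+2) = t V_(n+1) + s V_n; on s = 1 + t one has V_n = (-1)^n + s^n.  Hence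
   V_(2p) - s^(2p) = 1 on the quadric.  All the coefficients of V_(2p) are
   nonnegative and s^(2p) has 2p+1 monomials, so rescaling the monomials gives
   g_p, with N(p) the number of monomials of V_(2p).

   Minimality: every Hermitian form in 1 and the components of g_p that
   vanishes on the source is a multiple of the obvious one.  By torus
   invariance it splits according to the difference of exponents, and each part
   is a polynomial in the |z_j|^2 vanishing on s = 1 + t.  The s-degree
   determines the t-degree on the monomials, except for the pair
   1, t^(2p); so the part of least s-degree is homogeneous in t, whereas the
   lowest part of a multiple of s - t - 1 is divisible by 1 + t.  Comparing
   signatures then concludes. *)

Require Import Defs.
From HB Require Import structures.
From mathcomp Require Import all_boot all_order all_algebra.
From mathcomp Require Import reals complex.
From mathcomp Require Import mpoly.
From mathcomp Require Import zify ring.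

Set Implicit Arguments.
Unset Strict Implicit.
Unset Printing Implicit Defensive.

Import Order.TTheory GRing.Theory Num.Theory.
Local Open Scope ring_scope.

(** * Polynomials with infinitely many zeros, and points of the unit circle *)

Lemma poly_infinite_roots0 (D : idomainType) (f : nat -> D) (P : {poly D}) :
  injective f -> (forall n, P.[f n] = 0) -> P = 0.
Proof.
move=> f_inj f_root; apply/eqP; apply: contraT => nzP.
have := @max_poly_roots _ P (map f (iota 0 (size P))) nzP.
rewrite size_map size_iota ltnn map_inj_uniq ?iota_uniq //; apply => //.
by apply/allP => _ /mapP[n _ ->]; apply/rootP.
Qed.

Lemma poly_nat_roots0 (C : numDomainType) (P : {poly C}) :
  (forall n, P.[n.+1%:R] = 0) -> P = 0.
Proof.
apply: poly_infinite_roots0 => m n /eqP.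
by rewrite eqr_nat eqSS => /eqP.
Qed.

(* Rational parametrization of the unit circle. *)
Definition unit_pt (C : numClosedFieldType) (n : nat) : C :=
  (1 + n%:R * 'i) / (1 - n%:R * 'i).

Lemma unit_pt_den_neq0 (C : numClosedFieldType) n : 1 - n%:R * 'i != 0 :> C.
Proof.
apply/eqP => /eqP; rewrite subr_eq0 => /eqP e.
have := congr1 (fun x : C => x ^+ 2) e.
rewrite expr1n exprMn sqrCi mulrN1 => /eqP.
by rewrite -subr_eq0 opprK -natrX nat1r pnatr_eq0.
Qed.

Lemma unit_pt_inj (C : numClosedFieldType) : injective (unit_pt C).
Proof.
move=> m n /eqP; rewrite /unit_pt eqr_div ?unit_pt_den_neq0 // => /eqP e.
have e' : 2 * 'i * (m%:R - n%:R) = 0 :> C.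
  transitivity ((1 + m%:R * 'i) * (1 - n%:R * 'i) -
      (1 + n%:R * 'i) * (1 - m%:R * 'i) : C).
    by ring.
  by rewrite e subrr.
move/eqP: e'; rewrite !mulf_eq0 pnatr_eq0 (negPf (neq0Ci _)) /= subr_eq0 eqr_nat.
by move/eqP.
Qed.

Lemma unit_pt_conj (C : numClosedFieldType) n :
  unit_pt C n * (unit_pt C n)^* = 1.
Proof.
have d := unit_pt_den_neq0 C n.
have cd : (1 - n%:R * 'i)^* = 1 + n%:R * 'i :> C.
  by rewrite rmorphB rmorphM rmorph1 rmorph_nat /= conjCi mulrN opprK.
have cn : (1 + n%:R * 'i)^* = 1 - n%:R * 'i :> C by rewrite -cd conjCK.
have d' : 1 + n%:R * 'i != 0 :> C by rewrite -cd fmorph_eq0.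
by rewrite /unit_pt fmorph_div /= cn cd mulf_div [X in _ / X]mulrC divff // mulf_neq0.
Qed.

(** * Exponent vectors encoded as integers in base [q] *)

Lemma big_expansion_inj (k q : nat) (m n : nat -> nat) :
  (forall i, i < k -> m i < q)%N -> (forall i, i < k -> n i < q)%N ->
  (\sum_(i < k) m i * q ^ i = \sum_(i < k) n i * q ^ i)%N ->
  forall i, (i < k)%N -> m i = n i.
Proof.
elim: k m n => [//|k IHk] m n mq nq.
have q0 : (0 < q)%N by rewrite (leq_trans _ (mq 0%N isT)).
have shift (u : nat -> nat) : (\sum_(i < k.+1) u i * q ^ i =
    u 0 + (\sum_(i < k) u i.+1 * q ^ i) * q)%N.
  rewrite big_ord_recl muln1; congr addn; rewrite big_distrl /=.
  by apply: eq_bigr => i _; rewrite /bump /= expnSr mulnA.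
rewrite !shift => e.
have e0 : m 0%N = n 0%N.
  move: (congr1 (modn^~ q) e).
  by rewrite ![(_ + _ * q)%N]addnC !modnMDl !modn_small ?mq ?nq.
move: e; rewrite e0 => /addnI /eqP; rewrite eqn_pmul2r // => /eqP e.
by case=> [//|i] ik; apply: (IHk (m \o succn) (n \o succn)) => // j jk;
  [apply: mq | apply: nq].
Qed.

Section Weights.

Variables (k q : nat).

(** This is the exponent produced by the Kronecker substitution: setting the i-th variable to
    [c ^+ (q ^ i)] turns the monomial [m] into [c] to this power. *)
Definition radix_weight (m : 'X_{1..k}) : nat := (\sum_(i < k) m i * q ^ i)%N.

Lemma radix_weightD m n :
  radix_weight (m + n)%MM = (radix_weight m + radix_weight n)%N.
Proof.
by rewrite /radix_weight -big_split; apply: eq_bigr => i _ /=; rewrite mnmDE mulnDl.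
Qed.

Lemma radix_weight_inj (m n : 'X_{1..k}) :
  (forall i, m i < q)%N -> (forall i, n i < q)%N ->
  radix_weight m = radix_weight n -> m = n.
Proof.
move=> mq nq e; apply/mnmP => i.
(* Exponent vectors are extended by zero to functions on [nat], the form that [big_expansion_inj]
   expects. *)
pose ext (u : 'X_{1..k}) j := if insub j is Some j' then u j' else 0%N.
have extE (u : 'X_{1..k}) (j : 'I_k) : ext u j = u j by rewrite /ext valK.
have extq (u : 'X_{1..k}) : (forall i, u i < q)%N ->
    forall j, (j < k)%N -> (ext u j < q)%N.
  by move=> uq j jk; rewrite -[j]/(val (Ordinal jk)) extE.
rewrite -!extE; apply: (@big_expansion_inj k q) => //; try exact: extq.
by move: e; rewrite /radix_weight; under eq_bigr do rewrite -extE;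
  under [in RHS]eq_bigr do rewrite -extE.
Qed.

End Weights.

(** * Degrees in the two groups of variables *)

Section Bidegree.

Variables (a b : nat).
Implicit Type m : 'X_{1..a + b}.

Definition degl m : nat := (\sum_(j < a) m (lshift b j))%N.
Definition degr m : nat := (\sum_(j < b) m (rshift a j))%N.

Lemma deglD m n : degl (m + n)%MM = (degl m + degl n)%N.
Proof. by rewrite /degl -big_split; apply: eq_bigr => i _; rewrite mnmDE. Qed.

Lemma degrD m n : degr (m + n)%MM = (degr m + degr n)%N.
Proof. by rewrite /degr -big_split; apply: eq_bigr => i _; rewrite mnmDE. Qed.

Lemma mdeg_bideg m : mdeg m = (degl m + degr m)%N.
Proof. by rewrite mdegE big_split_ord. Qed.

(** With one extra factor per group on top of the Kronecker substitution, a monomial depends only on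
    its two degrees and its radix weight. The test points on the quadric have this form. *)
Lemma mmap1_bideg (C : comNzRingType) (q : nat) (l r c : C) m :
  mmap1 (fun i => (match split i with inl _ => l | inr _ => r end) * c ^+ (q ^ i)) m =
  l ^+ degl m * r ^+ degr m * c ^+ radix_weight q m.
Proof.
rewrite /mmap1 big_split_ord /= /radix_weight big_split_ord /=.
have -> : \prod_(i < a) ((match split (lshift b i) with inl _ => l | inr _ => r end) *
   c ^+ (q ^ i)) ^+ m (lshift b i) =
   l ^+ degl m * c ^+ (\sum_(i < a) m (lshift b i) * q ^ i).
  rewrite /degl -!prodrXr -big_split; apply: eq_bigr => i _ /=.
  by rewrite (unsplitK (inl i)) exprMn -exprM mulnC.
have -> : \prod_(i < b) ((match split (rshift a i) with inl _ => l | inr _ => r end) *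
   c ^+ (q ^ (a + i))) ^+ m (rshift a i) =
   r ^+ degr m * c ^+ (\sum_(i < b) m (rshift a i) * q ^ (a + i)).
  rewrite /degr -!prodrXr -big_split; apply: eq_bigr => i _ /=.
  by rewrite (unsplitK (inr i)) exprMn -exprM mulnC.
by rewrite exprD; ring.
Qed.

End Bidegree.

(** * Hermitian relations between monomials on the quadric *)

Lemma sqr_norm_sqrtC_mul (C : numClosedFieldType) (x c : C) (e : nat) : 0 <= x ->
  `|sqrtC x * c ^+ e| ^+ 2 = x * (`|c| ^+ 2) ^+ e.
Proof.
by move=> x0; rewrite normrM exprMn -normrX sqrtCK (ger0_norm x0) normrX exprAC.
Qed.

(** The phases of the coordinates isolate the pairs with a given difference of exponents, moving
    along [s = 1 + t] isolates the least degree in [s], and the relative sizes of the coordinates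
    isolate a single pair. The condition on the entry at the constant monomial rules out the
    relation that the map itself provides. *)
Lemma hermitian_form_eq0 (C : numClosedFieldType) (a b w : nat) (I : finType)
    (mon : I -> 'X_{1..a + b}) (h : I -> I -> C) :
  (0 < a)%N -> (0 < b)%N -> (0 < w)%N -> injective mon ->
  (forall i, [\/ mon i = 0%MM, (degr (mon i) + 2 * degl (mon i) = w)%N
              | degr (mon i) = 0%N /\ degl (mon i) = w]) ->
  (forall i i', mon i = 0%MM -> mon i' = 0%MM -> h i i' = 0) ->
  (forall z : 'I_(a + b) -> C,
     \sum_(j < a) `|z (lshift b j)| ^+ 2
       - \sum_(j < b) `|z (rshift a j)| ^+ 2 = 1 ->
     \sum_i \sum_i' h i i' * (mmap1 z (mon i) * (mmap1 z (mon i'))^*) = 0) ->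
  forall i i', h i i' = 0.
Proof.
move=> a0 b0 w0 mon_inj mon_deg h0 hQ.
(* With this radix, the weight of a monomial determines differences of exponents. *)
pose q := (2 * w).+2; pose W i := radix_weight q (mon i).
have monle i j : (mon i j <= w)%N.
  have le : (mon i j <= degl (mon i) + degr (mon i))%N.
    by rewrite -mdeg_bideg mdegE (bigD1 j) //= leq_addr.
  have /= := mon_deg i; case=> [-> | | []]; last 2 first.
  - by move: le; lia.
  - by move: le; lia.
  by rewrite mnm0E.
(* The test points have s = 1 + (n+1) and t = n+1; the moduli of their coordinates
   within each group are proportional to rho^(q^i). *)
pose rho r : C := r.+1%:R.
pose A r : C := \sum_(j < a) (rho r ^+ 2) ^+ (q ^ j).
pose B r : C := \sum_(j < b) (rho r ^+ 2) ^+ (q ^ (a + j)).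
have rho_gt0 r : 0 < rho r by rewrite ltr0n.
have A_gt0 r : 0 < A r.
  rewrite /A; case: (a) a0 => // a' _; rewrite big_ord_recl ltr_pwDl ?exprn_gt0 //.
  by apply: sumr_ge0 => j _; rewrite !exprn_ge0 // ltW.
have B_gt0 r : 0 < B r.
  rewrite /B; case: (b) b0 => // b' _; rewrite big_ord_recl ltr_pwDl ?exprn_gt0 //.
  by apply: sumr_ge0 => j _; rewrite !exprn_ge0 // ltW.
pose x r n : C := (1 + n.+1%:R) / A r.
pose y r n : C := n.+1%:R / B r.
have x_gt0 r n : 0 < x r n by rewrite divr_gt0 // addr_gt0 // ltr0n.
have y_gt0 r n : 0 < y r n by rewrite divr_gt0 // ltr0n.
pose U r n i := sqrtC (x r n) ^+ degl (mon i) * sqrtC (y r n) ^+ degr (mon i) *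
  rho r ^+ W i.
have U_gt0 r n i : 0 < U r n i.
  by rewrite !mulr_gt0 // exprn_gt0 // sqrtC_gt0.
(* The phase factor of a pair is [zeta] to the power [W i - W i']; adding [K] makes this exponent a
   natural number. *)
pose K := \max_i W i.
have leK i : (W i <= K)%N by rewrite /K leq_bigmax.
have phase (r n e : nat) :
    \sum_(ij | (W ij.1 + (K - W ij.2))%N == e)
      h ij.1 ij.2 * (U r n ij.1 * U r n ij.2) = 0.
  pose P := \sum_ij (h ij.1 ij.2 * (U r n ij.1 * U r n ij.2)) *:
    'X^(W ij.1 + (K - W ij.2)) : {poly C}.
  suff P0 : P = 0.
    transitivity P`_e; last by rewrite P0 coef0.
    rewrite coef_sum big_mkcond /=; apply: eq_bigr => ij _.
    by rewrite coefZ coefXn eq_sym; case: eqP; rewrite (mulr1, mulr0).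
  apply: (poly_infinite_roots0 (@unit_pt_inj C)) => l.
  pose zeta := unit_pt C l; pose c := rho r * zeta.
  have zz : zeta * zeta^* = 1 by exact: unit_pt_conj.
  have nc : `|c| ^+ 2 = rho r ^+ 2.
    by rewrite normrM exprMn [`|zeta| ^+ 2]normCK zz mulr1 ger0_norm // ltW.
  pose z (i : 'I_(a + b)) := (match split i with
    inl _ => sqrtC (x r n) | inr _ => sqrtC (y r n) end) * c ^+ (q ^ i).
  have zmon i : mmap1 z (mon i) = U r n i * zeta ^+ W i.
    by rewrite mmap1_bideg /U exprMn mulrA.
  have zmonC i : (mmap1 z (mon i))^* = U r n i * zeta^* ^+ W i.
    by rewrite zmon rmorphM rmorphXn /= (conj_Creal (gtr0_real (U_gt0 _ _ _))).
  have /hQ : \sum_(j < a) `|z (lshift b j)| ^+ 2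
       - \sum_(j < b) `|z (rshift a j)| ^+ 2 = 1.
    have -> : \sum_(j < a) `|z (lshift b j)| ^+ 2 = x r n * A r.
      rewrite mulr_sumr; apply: eq_bigr => j _.
      by rewrite /z (unsplitK (inl j)) sqr_norm_sqrtC_mul ?ltW ?nc.
    have -> : \sum_(j < b) `|z (rshift a j)| ^+ 2 = y r n * B r.
      rewrite mulr_sumr; apply: eq_bigr => j _.
      by rewrite /z (unsplitK (inr j)) sqr_norm_sqrtC_mul ?ltW ?nc.
    by rewrite !divfK ?gt_eqF // addrK.
  rewrite pair_bigA /= => e0; rewrite horner_sum.
  transitivity (zeta ^+ K * 0); last by rewrite mulr0.
  rewrite -[in RHS]e0 mulr_sumr; apply: eq_bigr => -[i i'] _ /=.
  rewrite hornerZ hornerXn zmon zmonC exprD.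
  rewrite -{2}(subnK (leK i')) exprD.
  have nz : zeta != 0.
    by apply: contra_eq_neq zz => ->; rewrite mul0r eq_sym oner_eq0.
  have -> : zeta^* ^+ W i' = (zeta ^+ W i')^-1.
    by rewrite -exprVn; congr (_ ^+ _); apply: (mulfI nz); rewrite zz divff.
  by field; rewrite expf_neq0.
(* Moving the subtracted terms across leaves sums of two exponent vectors, whose digits are at most
   [2 * w < q], so equal weights give equal monomials. *)
have transport i i' j j' : (W i + (K - W i') = W j + (K - W j'))%N ->
    (mon i + mon j' = mon j + mon i')%MM.
  move=> e; apply: (@radix_weight_inj _ q).
  - by move=> l; rewrite mnmDE; have := monle i l; have := monle j' l; rewrite /q; lia.
  - by move=> l; rewrite mnmDE; have := monle i' l; have := monle j l; rewrite /q; lia.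
  rewrite !radix_weightD -!/(W _).
  by have := leK i'; have := leK j'; move: e; lia.
move=> i i'; apply/eqP; apply: contraT => hii.
(* Among the nonzero entries, take one whose first monomial has least degree in [s]; [J] then
   collects the nonzero entries with the same difference of exponents. *)
case: (@arg_minnP _ (i, i') (fun ij => h ij.1 ij.2 != 0)
  (fun ij => degl (mon ij.1)) hii) => -[j j'] /= hj jmin.
pose e := (W j + (K - W j'))%N.
pose J := [pred ij | (W ij.1 + (K - W ij.2) == e)%N && (h ij.1 ij.2 != 0)].
(* Inside [J] the ratio [U l' / U l] is constant, so up to this factor the relation is a polynomial
   in the squared moduli. *)
have square r n : \sum_(ij | J ij) h ij.1 ij.2 * U r n ij.1 ^+ 2 = 0.
  have := phase r n e; rewrite (bigID (fun ij => h ij.1 ij.2 != 0)) /=.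
  rewrite [X in _ + X]big1 ?addr0 => [s|ij /andP[_]]; last first.
    by rewrite negbK => /eqP ->; rewrite mul0r.
  apply: (mulIf (lt0r_neq0 (U_gt0 r n j'))).
  transitivity (0 * U r n j); last by rewrite !mul0r.
  rewrite -[in RHS]s !mulr_suml.
  apply: eq_bigr => -[l l'] /andP[/eqP /= /transport t _].
  have {t} : U r n l * U r n j' = U r n j * U r n l'.
    have := congr1 (fun m => sqrtC (x r n) ^+ degl m * sqrtC (y r n) ^+ degr m *
      rho r ^+ radix_weight q m) t.
    rewrite !deglD !degrD !radix_weightD !exprD /U /W => t'.
    by apply: (etrans _ (etrans t' _)); ring.
  move=> t; transitivity (h l l' * U r n l * (U r n l * U r n j')); first by ring.
  by rewrite t; ring.
pose d0 := degl (mon j).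
(* Dividing by [s ^+ d0] and then setting [s = 0], that is [t = -1], keeps only the terms of least
   degree in [s]. *)
have lowest r : \sum_(ij | J ij && (degl (mon ij.1) == d0))
    h ij.1 ij.2 * rho r ^+ (2 * W ij.1) = 0.
  (* The point t = -1 is not on the quadric, but the polynomial identity reaches it. *)
  pose Q := \sum_(ij | J ij) (h ij.1 ij.2 * rho r ^+ (2 * W ij.1) /
      (A r ^+ degl (mon ij.1) * B r ^+ degr (mon ij.1))) *:
    (('X + 1) ^+ (degl (mon ij.1) - d0) * 'X^(degr (mon ij.1))) : {poly C}.
  have Q0 : Q = 0.
    apply: poly_nat_roots0 => n.
    have nz : 1 + n.+1%:R != 0 :> C by rewrite nat1r pnatr_eq0.
    apply: (mulIf (expf_neq0 d0 nz)).
    rewrite mul0r -(square r n) horner_sum mulr_suml.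
    apply: eq_bigr => -[l l'] /andP[_ hl]; have /= le := jmin _ hl.
    rewrite hornerZ hornerM hornerXn horner_exp hornerD hornerX hornerC.
    rewrite -{1}[n.+1%:R + 1]addrC.
    have -> : U r n l ^+ 2 = x r n ^+ degl (mon l) * y r n ^+ degr (mon l) *
        rho r ^+ (2 * W l).
      by rewrite /U [LHS]exprMn [X in X * _ = _]exprMn ![_ ^+ _ ^+ 2]exprAC !sqrtCK exprM.
    rewrite /x /y !expr_div_n -[in (1 + _) ^+ degl (mon l)](subnK le) exprD -/d0.
    by field; apply/andP; split; exact/expf_neq0/lt0r_neq0.
  have := congr1 (fun p : {poly C} => p.[-1]) Q0.
  rewrite horner0 horner_sum (bigID (fun ij => degl (mon ij.1) == d0)) /=.
  rewrite [X in _ + X]big1 ?addr0 => [|ij /andP[/andP[_ hl] ne]]; last first.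
    have le := jmin _ hl.
    rewrite hornerZ hornerM horner_exp hornerD hornerX hornerC addNr expr0n.
    by rewrite subn_eq0 leqNgt ltn_neqAle eq_sym ne le mul0r mulr0.
  move=> s; have nz : (-1) ^+ degr (mon j) / (A r ^+ d0 * B r ^+ degr (mon j)) != 0.
    by rewrite mulf_neq0 ?signr_eq0 // invr_eq0 mulf_neq0 // expf_neq0 // lt0r_neq0.
  apply: (mulIf nz); rewrite mul0r -[in RHS]s mulr_suml.
  apply: eq_bigr => -[l l'] /andP[/andP[/= /eqP t hl] /eqP /= le].
  rewrite hornerZ hornerM hornerXn horner_exp hornerD hornerX hornerC addNr le subnn.
  suff -> : degr (mon l) = degr (mon j) by ring.
  have {}t := transport _ _ _ _ t; rewrite /d0 in le.
  have deg0 u : mon u = 0%MM -> degl (mon u) = 0%N /\ degr (mon u) = 0%N.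
    by move=> u0; have := mdeg_bideg (mon u); rewrite {1}u0 mdeg0; lia.
  (* Equal degrees in [s] give equal degrees in [t], except for the constant monomial against one of
     bidegree [(0, w)]. There the exponents force both monomials of the first pair to be constant,
     where [h] vanishes. *)
  have excl u u' v v' : (mon u + mon v' = mon v + mon u')%MM -> mon u = 0%MM ->
      degl (mon v) = 0%N -> degr (mon v) = w -> h u u' = 0.
    move=> uv u0 lv rv; apply: h0 => //; apply/eqP; rewrite -mdeg_eq0 mdeg_bideg.
    have := congr1 (@degl a b) uv; have := congr1 (@degr a b) uv.
    rewrite !deglD !degrD; have [-> ->] := deg0 _ u0; rewrite lv rv.
    by case: (mon_deg v') => [/deg0[]||[]]; lia.
  case: (mon_deg l) => [/[dup] /deg0[? ?] l0|?|[? ?]];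
    case: (mon_deg j) => [/[dup] /deg0[? ?] j0|?|[? ?]]; try lia.
  - by move: hl; rewrite (excl _ _ _ _ t l0) ?eqxx //; lia.
  - by move: hj; rewrite (excl _ _ _ _ (esym t) j0) ?eqxx //; lia.
(* Now [rho] becomes the variable. Within [J], the exponent [2 * W l] determines [l] and hence [l'],
   so the coefficient at [2 * W j] is [h j j'] alone. *)
pose Q := \sum_(ij | J ij && (degl (mon ij.1) == d0))
  h ij.1 ij.2 *: 'X^(2 * W ij.1) : {poly C}.
have Q0 : Q = 0.
  apply: poly_nat_roots0 => r; rewrite -[RHS](lowest r) horner_sum.
  by apply: eq_bigr => ij _; rewrite hornerZ hornerXn.
have := congr1 (fun p : {poly C} => p`_(2 * W j)) Q0.
rewrite coef0 coef_sum (bigD1 (j, j')) /=; last by rewrite hj !eqxx.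
rewrite coefZ coefXn eqxx mulr1 big1 ?addr0 => [hj0|]; first by rewrite hj0 eqxx in hj.
case=> l l' /= /andP[/andP[/andP[/eqP t _] _] ne].
rewrite coefZ coefXn eqn_pmul2l //; case: eqP => [/esym el|]; last by rewrite mulr0.
have jl : j = l.
  have := transport l j' j j'; rewrite el => /(_ erefl) => t'.
  apply: mon_inj; apply/mnmP => k.
  by have := congr1 (fun m : 'X_{1..a + b} => m k) t'; rewrite !mnmDE; lia.
have jl' : j' = l'.
  have := transport _ _ _ _ t; rewrite jl => t'.
  apply: mon_inj; apply/mnmP => k.
  by have := congr1 (fun m : 'X_{1..a + b} => m k) t'; rewrite !mnmDE; lia.
by rewrite jl jl' eqxx in ne.
Qed.

(** * Signatures of Hermitian forms, and minimality of monomial maps *)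

Lemma big_option (C : nmodType) (T : finType) (F : option T -> C) :
  \sum_i F i = F None + \sum_i F (Some i).
Proof.
rewrite (bigD1 None) //=; congr (_ + _).
rewrite (reindex_omap Some id) => [|[i|]] //=.
by apply: eq_bigl => i; rewrite eqxx.
Qed.

Lemma hermitian_expand (C : numClosedFieldType) (I J : finType) (s : J -> C)
    (W : I -> C) (M : I -> J -> C) :
  \sum_j s j * `|\sum_i W i * M i j| ^+ 2 =
  \sum_i \sum_i' (\sum_j s j * (M i j * (M i' j)^*)) * (W i * (W i')^*).
Proof.
transitivity (\sum_j \sum_i \sum_i' s j * (M i j * (M i' j)^*) * (W i * (W i')^*)).
  apply: eq_bigr => j _.
  rewrite normCK rmorph_sum big_distrlr /= mulr_sumr; apply: eq_bigr => i _.
  rewrite mulr_sumr; apply: eq_bigr => i' _; rewrite rmorphM /=; ring.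
rewrite exchange_big; apply: eq_bigr => i _ /=.
by rewrite exchange_big; apply: eq_bigr => i' _ /=; rewrite mulr_suml.
Qed.

Definition split_sign (C : numClosedFieldType) (A B : nat) (j : 'I_(A + B)) : C :=
  if split j is inl _ then 1 else -1.

Definition split_form (C : numClosedFieldType) (A B : nat) (z : 'rV[C]_(A + B)) : C :=
  \sum_j split_sign C j * `|z 0 j| ^+ 2.

Lemma split_formE (C : numClosedFieldType) (A B : nat) (z : 'rV[C]_(A + B)) :
  split_form z = \sum_(j < A) `|z 0 (lshift B j)| ^+ 2
                 - \sum_(j < B) `|z 0 (rshift A j)| ^+ 2.
Proof.
rewrite /split_form big_split_ord /= -sumrN; congr (_ + _); apply: eq_bigr => j _.
  by rewrite /split_sign (unsplitK (inl j)) mul1r.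
by rewrite /split_sign (unsplitK (inr j)) mulN1r.
Qed.

Lemma sqr_norm_gt0 (C : numClosedFieldType) (n : nat) (u : 'rV[C]_n) :
  u != 0 -> 0 < \sum_j `|u 0 j| ^+ 2.
Proof.
case/rV0Pn => j uj; rewrite (bigD1 j) //= ltr_pwDl ?exprn_gt0 ?normr_gt0 //.
by apply: sumr_ge0 => k _; rewrite exprn_ge0.
Qed.

Lemma sqr_norm_ge0 (C : numClosedFieldType) (n : nat) (f : 'I_n -> C) :
  0 <= \sum_j `|f j| ^+ 2.
Proof. by apply: sumr_ge0 => k _; rewrite exprn_ge0. Qed.

Lemma mx_left_kernel (F : fieldType) (m n : nat) (X : 'M[F]_(m, n)) :
  (n < m)%N -> exists2 u : 'rV_m, u != 0 & u *m X = 0.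
Proof.
move=> nm; have /rowV0Pn[u] : kermx X != 0.
  by rewrite -mxrank_eq0 mxrank_ker -lt0n subn_gt0 (leq_ltn_trans (rank_leq_col X)).
by rewrite sub_kermx => /eqP uX nu; exists u.
Qed.

(** As in Sylvester's law of inertia: if [A < N], a nonzero vector of the positive part is sent to
    one with no positive coordinates, so a positive value would be nonpositive. The negative parts
    are symmetric. *)
Lemma split_form_signature_le (C : numClosedFieldType) (N K A B : nat)
    (M : 'M[C]_(N + K, A + B)) :
  (forall u, split_form (u *m M) = split_form u) -> (N <= A)%N /\ (K <= B)%N.
Proof.
move=> MQ; split; rewrite leqNgt; apply/negP => /mx_left_kernel.
- case/(_ _ (lsubmx (usubmx M))) => u nu uM.
  have := MQ (row_mx u 0); rewrite !split_formE.
  rewrite big1 => [|j _]; last first.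
    rewrite -[M]vsubmxK mul_row_col mul0mx addr0.
    have /rowP/(_ j) := uM; rewrite mulmx_lsub mxE [RHS]mxE => ->.
    by rewrite normr0 expr0n.
  rewrite [X in _ = _ - X]big1 => [|j _]; last first.
    by rewrite row_mxEr mxE normr0 expr0n.
  under [in RHS]eq_bigr do rewrite row_mxEl.
  rewrite sub0r subr0 => /eqP; apply/negP; rewrite lt_eqF //.
  by rewrite (le_lt_trans _ (sqr_norm_gt0 nu)) // oppr_le0 sqr_norm_ge0.
- case/(_ _ (rsubmx (dsubmx M))) => u nu uM.
  have := MQ (row_mx 0 u); rewrite !split_formE.
  rewrite [X in _ - X = _]big1 => [|j _]; last first.
    rewrite -[M]vsubmxK mul_row_col mul0mx add0r.
    have /rowP/(_ j) := uM; rewrite mulmx_rsub mxE [RHS]mxE => ->.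
    by rewrite normr0 expr0n.
  rewrite [X in _ = X - _]big1 => [|j _]; last first.
    by rewrite row_mxEl mxE normr0 expr0n.
  under [in RHS]eq_bigr do rewrite row_mxEr.
  rewrite sub0r subr0 => /eqP; apply/negP; rewrite gt_eqF //.
  by rewrite (lt_le_trans _ (sqr_norm_ge0 _)) // oppr_lt0 sqr_norm_gt0.
Qed.

(** The pulled-back equation of the competing quadric is a Hermitian relation in 1 and the
    monomials, hence a multiple of the relation given by [g]. Surjectivity forces [v = 0], which
    makes the multiple 1, so [M] preserves the split forms and inertia applies. *)
Lemma monomial_map_minimal (R : realType) (a b w N K : nat)
    (g : poly_map R (a + b) (N + K)) (c : 'I_(N + K) -> R[i])
    (mon : 'I_(N + K) -> 'X_{1..a + b}) :
  (0 < a)%N -> (0 < b)%N -> (0 < w)%N ->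
  (forall i, g i = c i *: 'X_[mon i]) -> (forall i, c i != 0) -> injective mon ->
  (forall i, (degr (mon i) + 2 * degl (mon i) = w)%N
             \/ degr (mon i) = 0%N /\ degl (mon i) = w) ->
  maps_hyperquadric a b N K (eval_map g) ->
  forall A B : nat, maps_to_some_hyperquadric a b (eval_map g) A B ->
  (N <= A)%N /\ (K <= B)%N.
Proof.
move=> a0 b0 w0 gE c0 mon_inj mon_deg gQ A B [M [v [Mfull MQ]]].
pose C : numClosedFieldType := R[i].
(* The index [None] stands for the constant 1, whose coefficients are the translation [v]. *)
pose I : finType := option 'I_(N + K).
pose mo (i : I) := if i is Some i' then mon i' else 0%MM.
pose co (i : I) : C := if i is Some i' then c i' else 1.
pose Mo (i : I) j : C := if i is Some i' then M i' j else v 0 j.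
pose D i i' := \sum_j split_sign C j * (Mo i j * (Mo i' j)^*).
pose T (i i' : I) : C :=
  if i == i' then (if i is Some i1 then split_sign C i1 else -1) else 0.
pose D1 i i' := D i i' - (if (i, i') is (None, None) then 1 else 0).
(* [D1] is the relation of the competing quadric and [T] that of [g]. Since [T None None = -1], this
   combination vanishes at [(None, None)]; the factors [co] pass from components to monomials. *)
pose h i i' := (D1 i i' + D1 None None * T i i') * (co i * (co i')^*).
have mon_neq0 i : mon i != 0%MM.
  by rewrite -mdeg_eq0 mdeg_bideg; have := mon_deg i; lia.
have key i i' : h i i' = 0.
  move: i i'; apply: (@hermitian_form_eq0 C a b w I mo) => //.
  - case=> [i|] [i'|] //=; first by move/mon_inj ->.
      by move/eqP; rewrite (negPf (mon_neq0 _)).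
    by move/esym/eqP; rewrite (negPf (mon_neq0 _)).
  - case=> [i|] /=; last by constructor 1.
    by case: (mon_deg i) => ?; [constructor 2|constructor 3].
  - case=> [i|] [i'|] //=; try by move=> /eqP; rewrite (negPf (mon_neq0 _)).
      by move=> _ /eqP; rewrite (negPf (mon_neq0 _)).
    by move=> _ _; rewrite /h /T eqxx mulrN1 subrr mul0r.
  move=> z zQ; pose zr : 'rV[C]_(a + b) := \row_i z i.
  have {}zQ : hyperquadric a b zr.
    rewrite /hyperquadric -[RHS]zQ.
    by congr (_ - _); apply: eq_bigr => j _; rewrite mxE.
  pose W i := co i * mmap1 z (mo i).
  have WE i : (eval_map g zr) 0 i = W (Some i).
    rewrite mxE gE mevalZ mevalX; congr (_ * _); apply: eq_bigr => j _.
    by rewrite mxE.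
  have W0 : W None = 1 by rewrite /W mmap11 mulr1.
  have e1 : \sum_i \sum_i' D i i' * (W i * (W i')^*) = 1.
    rewrite -hermitian_expand -[RHS](MQ zr zQ) -split_formE.
    apply: eq_bigr => j _; congr (_ * `|_| ^+ 2).
    rewrite big_option /= W0 mul1r !mxE addrC; congr (_ + _).
    by apply: eq_bigr => i _; rewrite WE.
  have e2 : \sum_i \sum_i' T i i' * (W i * (W i')^*) = 0.
    transitivity (\sum_i T i i * `|W i| ^+ 2).
      apply: eq_bigr => i _; rewrite (bigD1 i) //= big1 ?addr0 ?normCK // => i' ne.
      by rewrite /T eq_sym (negPf ne) mul0r.
    rewrite big_option /= {1}/T eqxx W0 normr1 expr1n mulr1.
    apply/eqP; rewrite addrC subr_eq0; apply/eqP.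
    rewrite -[RHS](gQ zr zQ) -split_formE; apply: eq_bigr => i _.
    by rewrite WE /T eqxx.
  have e3 : \sum_i \sum_i' D1 i i' * (W i * (W i')^*) = 0.
    transitivity (1 - \sum_i \sum_i' (if (i, i') is (None, None) then 1 else 0) *
        (W i * (W i')^*)).
      rewrite -[X in _ = X - _]e1 -sumrB; apply: eq_bigr => i _.
      by rewrite -sumrB; apply: eq_bigr => i' _; rewrite mulrBl.
    rewrite !big_option /= W0 rmorph1 !mulr1 !big1 ?addr0 ?subrr // => i _.
      by rewrite big1 // => i' _; rewrite mul0r.
    by rewrite mul0r.
  transitivity (\sum_i \sum_i' (D1 i i' * (W i * (W i')^*) +
      D1 None None * (T i i' * (W i * (W i')^*)))).
    apply: eq_bigr => i _; apply: eq_bigr => i' _.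
    by rewrite /h /W !rmorphM /=; ring.
  under eq_bigr do rewrite big_split -mulr_sumr.
  by rewrite big_split -mulr_sumr /= e2 e3 mulr0 addr0.
have {}key i i' : D1 i i' = - D1 None None * T i i'.
  apply/eqP; rewrite mulNr -addr_eq0; apply/eqP.
  have cn i0 : co i0 != 0 by case: i0 => [i0|] /=; rewrite ?oner_eq0.
  have nz : co i * (co i')^* != 0 by rewrite mulf_neq0 // fmorph_eq0.
  by apply: (mulIf nz); rewrite mul0r -(key i i').
(* The mixed entries say that [v] is orthogonal to every row of [M]; a left inverse [L] of [M]
   extracts each coordinate of [v]. *)
have v0 j : v 0 j = 0.
  have /row_fullP[L LM] := Mfull.
  have e i : D None (Some i) = 0.
    by have := key None (Some i); rewrite /D1 /T subr0 mulr0.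
  have : \sum_i (L j i)^* * D None (Some i) = 0.
    by rewrite big1 // => i _; rewrite e mulr0.
  rewrite /D; under eq_bigr do rewrite mulr_sumr.
  rewrite exchange_big /= (bigD1 j) //=.
  have LMj k : \sum_i (L j i)^* * (split_sign C k * (v 0 k * (M i k)^*)) =
      split_sign C k * v 0 k * (j == k)%:R.
    have /matrixP/(_ j k) := LM; rewrite !mxE => e'.
    rewrite -[(j == k)%:R]conjCK rmorph_nat -e' rmorph_sum mulr_sumr.
    by apply: eq_bigr => i _; rewrite rmorphM /=; ring.
  rewrite LMj eqxx mulr1 big1 ?addr0 => [|k kj]; last first.
    by rewrite LMj eq_sym (negPf kj) mulr0.
  move/eqP; rewrite mulf_eq0 /split_sign => /orP[|/eqP //].
  by case: split => _; rewrite ?oppr_eq0 oner_eq0.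
have D00 : D1 None None = -1.
  by rewrite /D1 /D big1 ?sub0r // => j _; rewrite /= v0 mul0r mulr0.
apply: (@split_form_signature_le C N K A B M) => u.
transitivity (\sum_j split_sign C j * `|\sum_i u 0 i * M i j| ^+ 2).
  by apply: eq_bigr => j _; rewrite mxE.
rewrite hermitian_expand; apply: eq_bigr => i _.
have DE i' : \sum_j split_sign C j * (M i j * (M i' j)^*) = T (Some i) (Some i').
  by have := key (Some i) (Some i'); rewrite D00 opprK mul1r /D1 subr0.
under eq_bigr do rewrite DE.
rewrite (bigD1 i) //= big1 ?addr0 => [|i' ne]; last first.
  by rewrite /T (inj_eq Some_inj) eq_sym (negPf ne) mul0r.
by rewrite /T eqxx normCK.
Qed.

(** * Lucas polynomials *)

(** The companion Lucas sequence [V_n(x, -y)], the sum of the n-th powers of the roots of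
    [X^2 - x X - y]; hence the value 2 at [n = 0]. *)
Fixpoint lucas (A : comNzRingType) (x y : A) (n : nat) : A :=
  if n is n1.+1 then
    if n1 is n2.+1 then x * lucas x y n1 + y * lucas x y n2 else x
  else 2%:R.

Lemma lucasSS (A : comNzRingType) (x y : A) n :
  lucas x y n.+2 = x * lucas x y n.+1 + y * lucas x y n.
Proof. by []. Qed.

Lemma lucas_ind (P : nat -> Prop) :
  P 0%N -> P 1%N -> (forall n, P n -> P n.+1 -> P n.+2) -> forall n, P n.
Proof.
move=> P0 P1 PS n; suff [] : P n /\ P n.+1 by [].
by elim: n => [//|n [Pn Pn1]]; split=> //; apply: PS.
Qed.

(* The roots of [X^2 - t X - (1 + t)] are [-1] and [1 + t]. *)
Lemma lucas_root (A : comNzRingType) (t : A) n :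
  lucas t (1 + t) n = (-1) ^+ n + (1 + t) ^+ n.
Proof.
elim/lucas_ind: n => [||n IHn IHn1]; rewrite ?lucasSS ?IHn ?IHn1 /=; try by ring.
by rewrite !exprS; ring.
Qed.

Lemma rmorph_lucas (A B : comNzRingType) (f : {rmorphism A -> B}) x y n :
  f (lucas x y n) = lucas (f x) (f y) n.
Proof.
elim/lucas_ind: n => [||n IHn IHn1] //; first by rewrite /= rmorph_nat.
by rewrite !lucasSS rmorphD !rmorphM IHn IHn1.
Qed.

(** * Weighted homogeneity and positivity *)

Section WeightedHomogeneous.

Variables (C : comNzRingType) (a b : nat).
Implicit Types P Q : {mpoly C[a + b]}.

(** Weights 2 for the first group and 1 for the second make both terms of the Lucas recurrence
    homogeneous of the same weight when [x] is [t] and [y] is [s]. *)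
Definition whomog d P :=
  forall m, m \in msupp P -> (degr m + 2 * degl m = d)%N.

Lemma whomogD d P Q : whomog d P -> whomog d Q -> whomog d (P + Q).
Proof. by move=> hP hQ m /msuppD_le; rewrite mem_cat => /orP[/hP|/hQ]. Qed.

Lemma whomogM d e P Q : whomog d P -> whomog e Q -> whomog (d + e) (P * Q).
Proof.
move=> hP hQ m /msuppM_le /allpairsP[[m1 m2] [/= /hP <- /hQ <- ->]].
by rewrite deglD degrD; lia.
Qed.

Lemma whomog_sum (I : finType) d (F : I -> {mpoly C[a + b]}) :
  (forall i, whomog d (F i)) -> whomog d (\sum_i F i).
Proof.
move=> hF; apply: (big_ind (whomog d)) => //; last exact: whomogD.
by move=> m; rewrite msupp0.
Qed.

Lemma bideg_lshift (i : 'I_a) :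
  degl (U_(lshift b i) : 'X_{1..a + b})%MM = 1%N /\
  degr (U_(lshift b i) : 'X_{1..a + b})%MM = 0%N.
Proof.
have l1 : degl (U_(lshift b i) : 'X_{1..a + b})%MM = 1%N.
  rewrite /degl (bigD1 i) //= mnm1E eqxx big1 // => j ji.
  by rewrite mnm1E (inj_eq (@lshift_inj _ _)) eq_sym (negPf ji).
by have := mdeg_bideg (U_(lshift b i) : 'X_{1..a + b})%MM; rewrite mdeg1 l1; lia.
Qed.

Lemma bideg_rshift (i : 'I_b) :
  degl (U_(rshift a i) : 'X_{1..a + b})%MM = 0%N /\
  degr (U_(rshift a i) : 'X_{1..a + b})%MM = 1%N.
Proof.
have l0 : degl (U_(rshift a i) : 'X_{1..a + b})%MM = 0%N.
  by rewrite /degl big1 // => j _; rewrite mnm1E eq_rlshift.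
by have := mdeg_bideg (U_(rshift a i) : 'X_{1..a + b})%MM; rewrite mdeg1 l0; lia.
Qed.

Lemma whomog_X m : whomog (degr m + 2 * degl m) 'X_[m].
Proof. by move=> n; rewrite msuppX inE => /eqP ->. Qed.

Lemma whomog_lucas P Q n : whomog 1 P -> whomog 2 Q -> whomog n (lucas P Q n).
Proof.
move=> hP hQ; elim/lucas_ind: n => [||n IHn IHn1] //.
  move=> m; rewrite /= -mpolyC_nat msuppC; case: ifP => // _.
  rewrite inE => /eqP ->; rewrite /degl /degr.
  by rewrite !big1 // => i _; rewrite mnm0E.
by rewrite lucasSS; apply: whomogD; [apply: (whomogM hP)|apply: (whomogM hQ)].
Qed.

End WeightedHomogeneous.

(** Nonnegative coefficients have real square roots, by which the monomials can be rescaled. *)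
Lemma mcoeff_lucas_ge0 (C : numDomainType) k (P Q : {mpoly C[k]}) n :
  (forall m, 0 <= P@_m) -> (forall m, 0 <= Q@_m) -> forall m, 0 <= (lucas P Q n)@_m.
Proof.
move=> P0 Q0.
have coefM (U V : {mpoly C[k]}) :
    (forall m, 0 <= U@_m) -> (forall m, 0 <= V@_m) -> forall m, 0 <= (U * V)@_m.
  by move=> U0 V0 m; rewrite mcoeffM sumr_ge0 // => ij _; rewrite mulr_ge0.
elim/lucas_ind: n => [||n IHn IHn1] m //.
  by rewrite /= -mpolyC_nat mcoeffC mulr_ge0 ?ler0n.
by rewrite lucasSS mcoeffD addr_ge0 ?coefM.
Qed.

(** * Construction of the map *)

Theorem theorem6p1 (R : realType) (p : nat) (hp : (1 <= p)%N) :
  exists (N : nat) (g : poly_map R (2 + (2 * p + 1)) (N + (2 * p + 1))),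
    [/\ map_degree g = (2 * p)%N,
        maps_hyperquadric 2 (2 * p + 1) N (2 * p + 1) (eval_map g)
      & forall A B : nat, (A < N)%N \/ (B < 2 * p + 1)%N ->
          ~ maps_to_some_hyperquadric 2 (2 * p + 1) (eval_map g) A B].
Proof.
pose C : numClosedFieldType := R[i].
pose b := (2 * p + 1)%N.
(* [tau] and [sigma] are [t] and [s] with each squared modulus replaced by an indeterminate. *)
pose tau : {mpoly C[2 + b]} := \sum_(j < b) 'X_(rshift 2 j).
pose sigma : {mpoly C[2 + b]} := \sum_(j < 2) 'X_(lshift b j).
pose F := lucas tau sigma (2 * p).
have F_whomog : whomog (2 * p) F.
  apply: whomog_lucas; apply: whomog_sum => j m; rewrite msuppX inE => /eqP ->.
    by have [-> ->] := @bideg_rshift 2 b j.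
  by have [-> ->] := @bideg_lshift 2 b j.
have F_ge0 : forall m, 0 <= F@_m.
  by apply: mcoeff_lucas_ge0 => m; rewrite /tau /sigma raddf_sum sumr_ge0 //= => j _;
    rewrite mcoeffX ler0n.
pose N := size (msupp F).
(* These are the [2 * p + 1] monomials of [sigma ^+ (2 * p)], with binomial coefficients. *)
pose neg k : 'X_{1..2 + b} := (U_(lshift b ord0) *+ (2 * p - k) +
  U_(lshift b ord_max) *+ k)%MM.
pose mon (i : 'I_(N + b)) :=
  match split i with inl j => nth 0%MM (msupp F) j | inr k => neg k end.
pose coef (i : 'I_(N + b)) : C :=
  match split i with inl j => F@_(nth 0%MM (msupp F) j) | inr k => 'C(2 * p, k)%:R end.
pose g : poly_map R (2 + b) (N + b) := fun i => sqrtC (coef i) *: 'X_[mon i].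
have ltb (k : 'I_b) : (k <= 2 * p)%N by have := ltn_ord k; rewrite /b; lia.
have bideg_neg (k : 'I_b) : degr (neg k) = 0%N /\ degl (neg k) = (2 * p)%N.
  split.
    by rewrite /degr big1 // => j _; rewrite mnmDE !mulmnE !mnm1E !eq_lrshift.
  rewrite /degl big_ord_recl big_ord1 !mnmDE !mulmnE !mnm1E.
  rewrite !(inj_eq (@lshift_inj _ _)) /=; have := ltb k; lia.
have mon_deg i : (degr (mon i) + 2 * degl (mon i) = 2 * p)%N
             \/ degr (mon i) = 0%N /\ degl (mon i) = (2 * p)%N.
  rewrite /mon; case: (split i) => j; [left | right; exact: bideg_neg].
  by apply: F_whomog; apply: mem_nth.
(* The weight of [neg k] is [4 * p], while [F] has weight [2 * p]. *)
have neg_notin (k : 'I_b) : neg k \notin msupp F.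
  by apply/negP => /F_whomog; have [-> ->] := bideg_neg k; lia.
have mon_inj : injective mon.
  move=> i i' e; apply: (can_inj (@splitK N b)); move: e; rewrite /mon.
  case: (split i) => j; case: (split i') => j' e.
  - congr inl; apply: val_inj; apply/eqP.
    by rewrite -(nth_uniq 0%MM (ltn_ord j) (ltn_ord j') (msupp_uniq F)) e.
  - by have := neg_notin j'; rewrite -e mem_nth.
  - by have := neg_notin j; rewrite e mem_nth.
  - congr inr; apply: val_inj; move/mnmP/(_ (lshift b ord_max)): e.
    by rewrite !mnmDE !mulmnE !mnm1E !(inj_eq (@lshift_inj _ _)) /= !mul0n !mul1n.
have coef_ge0 i : 0 <= coef i.
  by rewrite /coef; case: (split i) => j; rewrite ?ler0n.
have coef_neq0 i : coef i != 0.
  rewrite /coef; case: (split i) => j; first by rewrite mcoeff_eq0 negbK mem_nth.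
  by rewrite pnatr_eq0 -lt0n bin_gt0.
have gdeg i : (msize (g i)).-1 = mdeg (mon i).
  by rewrite /g msizeZ ?sqrtC_eq0 // msizeX.
have gQ : maps_hyperquadric 2 b N b (eval_map g).
  move=> z zQ; pose x i : C := `|z 0 i| ^+ 2.
  have gz i : `|(eval_map g z) 0 i| ^+ 2 = coef i * mmap1 x (mon i).
    rewrite mxE mevalZ mevalX normrM exprMn -normrX sqrtCK (ger0_norm (coef_ge0 i)).
    rewrite normr_prod -prodrXl; congr (_ * _); apply: eq_bigr => j _.
    by rewrite normrX exprAC.
  pose t := \sum_(j < b) x (rshift 2 j); pose s := \sum_(j < 2) x (lshift b j).
  have st : s = 1 + t by rewrite -[1]zQ subrK.
  rewrite /hyperquadric.
  have -> : \sum_(j < N) `|(eval_map g z) 0 (lshift b j)| ^+ 2 = 1 + s ^+ (2 * p).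
    transitivity (F.@[x]).
      rewrite mevalE (big_nth 0%MM) big_mkord; apply: eq_bigr => j _.
      by rewrite gz /coef /mon (unsplitK (inl j)).
    rewrite /F rmorph_lucas !rmorph_sum /=.
    under eq_bigr do rewrite mevalXU.
    under [X in lucas _ X _]eq_bigr do rewrite mevalXU.
    (* The exponent is even, so the root [-1] contributes exactly 1. *)
    by rewrite -/t -/s st lucas_root exprM sqrrN expr1n expr1n.
  suff -> : \sum_(j < b) `|(eval_map g z) 0 (rshift N j)| ^+ 2 = s ^+ (2 * p).
    by rewrite addrK.
  have exprDb (u v : C) :
      (u + v) ^+ (2 * p) = \sum_(k < b) u ^+ (2 * p - k) * v ^+ k *+ 'C(2 * p, k).
    by rewrite /b addn1 exprDn.
  rewrite /s big_ord_recl big_ord1 exprDb.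
  apply: eq_bigr => k _; rewrite gz /coef /mon (unsplitK (inr k)) mulr_natl.
  have -> : mmap1 x (neg k) = ('X_[neg k]).@[x] by rewrite mevalX.
  rewrite /neg mpolyXD -!mpolyXn mevalM !rmorphXn /= !mevalXU.
  by congr (_ * x (lshift b _) ^+ _ *+ _); apply: val_inj.
exists N, g; split => //.
- have b0 : (0 < b)%N by rewrite /b addn1.
  apply/eqP; rewrite eqn_leq; apply/andP; split.
    apply/bigmax_leqP => i _; rewrite gdeg mdeg_bideg.
    by have := mon_deg i; lia.
  (* The component from [neg 0], a power of the first variable, attains the degree. *)
  apply: leq_trans (leq_bigmax (rshift N (Ordinal b0))).
  rewrite gdeg mdeg_bideg /mon (unsplitK (inr _)).
  by have [-> ->] := bideg_neg (Ordinal b0); rewrite addn0.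
- move=> A B AB /(@monomial_map_minimal R 2 b (2 * p) N b g
    (fun i => sqrtC (coef i)) mon) [] //.
  + by rewrite /b addn1.
  + by rewrite muln_gt0.
  + by move=> i; rewrite sqrtC_eq0.
  + by move: AB; rewrite -/b; lia.
Qed.
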